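(* For positive integers $m$ and $n$, $\mathbf{Co}(\boldsymbol{m})$ belongs to $\mathbf{SUB}_n$ if and only if $m\le n+1$. In particular, $\mathbf{SUB}_n$ is a proper subvariety of $\mathbf{SUB}_{n+1}$, for every positive integer $n$.
   Context: For a positive integer $m$, $\boldsymbol{m}$ denotes the $m$-element chain. For a poset $(P,\trianglelefteq)$, a subset $X\subseteq P$ is order-convex if $x\trianglelefteq z\trianglelefteq y$ and $\{x,y\}\subseteq X$ imply $z\in X$. $\mathbf{Co}(P)$ is the lattice of all order-convex subsets of $P$ under inclusion. The length of $P$ is the supremum of $|C|-1$ over finite subchains $C$ of $P$. For a positive integer $n$, $\mathbf{SUB}_n$ is the class of all lattices that can be embedded into $\mathbf{Co}(P)$ for some poset $P$ of length at most $n$ (it is a variety). *)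

(* Defs.v *)
From HB Require Import structures.
From mathcomp Require Import all_boot all_order finmap.
From mathcomp Require Import boolp classical_sets.

Set Implicit Arguments.
Unset Strict Implicit.
Unset Printing Implicit Defensive.

Import Order.TTheory.
Local Open Scope order_scope.
Local Open Scope classical_set_scope.

Definition order_convex d (P : porderType d) (X : set P) : Prop :=
  forall x y z : P, X x -> X y -> x <= z -> z <= y -> X z.

Record Co d (P : porderType d) : Type := MkCo {
  co_set :> set P;
  co_setP : `[< order_convex co_set >]
}.

HB.instance Definition _ d (P : porderType d) :=
  [isSub for @co_set d P].
HB.instance Definition _ d (P : porderType d) := [Choice of Co P by <:].
(* The order inherited from [set P] is inclusion. *)
HB.instance Definition _ d (P : porderType d) :=
  [SubChoice_isSubPOrder of Co P by <: with set_display].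

Section CoLattice.
Context d (P : porderType d).
Implicit Types X Y Z : Co P.

Lemma co_convex X : order_convex X.
Proof. exact/asboolP/(co_setP X). Qed.

Lemma leCoP X Y : reflect ((X : set P) `<=` Y) (X <= Y).
Proof. exact: asboolP. Qed.

Lemma co_meet_subproof X Y : `[< order_convex ((X : set P) `&` Y) >].
Proof.
apply/asboolP => x y z [Xx Yx] [Xy Yy] xz zy.
by split; [exact: (co_convex Xx Xy xz zy)|exact: (co_convex Yx Yy xz zy)].
Qed.

Definition co_meet X Y : Co P := MkCo (co_meet_subproof X Y).

(* The order-convex subset generated by [A]. *)
Definition co_hull (A : set P) : set P :=
  [set z | exists x y, [/\ A x, A y, x <= z & z <= y]].

Lemma co_hull_subproof (A : set P) : `[< order_convex (co_hull A) >].
Proof.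
apply/asboolP => x y z [a [_ [Aa _ ax _]]] [_ [b [_ Ab _ yb]]] xz zy.
by exists a, b; split => //; [exact: le_trans ax xz|exact: le_trans zy yb].
Qed.

Definition co_join X Y : Co P := MkCo (co_hull_subproof ((X : set P) `|` Y)).

Lemma co_meetP X Y Z : (X <= co_meet Y Z) = (X <= Y) && (X <= Z).
Proof.
apply/leCoP/andP => [XYZ|[/leCoP XY /leCoP XZ] x Xx].
- by split; apply/leCoP => x /XYZ[].
- by split; [exact: XY|exact: XZ].
Qed.

Lemma co_joinP X Y Z : (co_join X Y <= Z) = (X <= Z) && (Y <= Z).
Proof.
apply/leCoP/andP => [XYZ|[/leCoP XZ /leCoP YZ] z [x [y [XYx XYy xz zy]]]].
- by split; apply/leCoP => x Xx; apply: XYZ; exists x, x; split;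
    rewrite ?lexx//; [left|left|right|right].
- have UZ : (X : set P) `|` Y `<=` Z by move=> t [/XZ|/YZ].
  exact: (co_convex (UZ _ XYx) (UZ _ XYy) xz zy).
Qed.

HB.instance Definition _ := Order.POrder_MeetJoin_isLattice.Build
  set_display (Co P) co_meetP co_joinP.

End CoLattice.

Definition length_at_most d (P : porderType d) (n : nat) : Prop :=
  forall C : {fset P},
    {in C &, forall x y : P, x >=< y} -> (#|` C| - 1 <= n)%N.

Definition lattice_embeds d (L : latticeType d) d' (K : latticeType d') : Prop :=
  exists f : {lmorphism L -> K}, injective f.

Definition lattice_class : Type :=
  forall d : Order.disp_t, latticeType d -> Prop.

Definition SUB (n : nat) : lattice_class := fun d L =>
  exists (d' : Order.disp_t) (P : porderType d'),
    length_at_most P n /\ lattice_embeds L (Co P).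

(* Direct product of an arbitrary family of lattices, ordered pointwise. *)
Definition prod_lattice (I : Type) (d : I -> Order.disp_t)
  (L : forall i, latticeType (d i)) : Type := forall i, L i.

HB.instance Definition _ I d (L : forall i : I, latticeType (d i)) :=
  gen_eqMixin (prod_lattice L).
HB.instance Definition _ I d (L : forall i : I, latticeType (d i)) :=
  gen_choiceMixin (prod_lattice L).

Fact prod_lattice_display : Order.disp_t.
Proof. exact: Order.Disp tt tt. Qed.

Section ProdLattice.
Context (I : Type) (d : I -> Order.disp_t) (L : forall i, latticeType (d i)).
Implicit Types x y z : prod_lattice L.

Definition prod_le x y : bool := `[< forall i, x i <= y i >].

Lemma prod_le_refl : reflexive prod_le.
Proof. by move=> x; apply/asboolP => i; exact: lexx. Qed.

Lemma prod_le_anti : antisymmetric prod_le.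
Proof.
move=> x y /andP[/asboolP xy /asboolP yx].
by apply: functional_extensionality_dep => i; apply/le_anti; rewrite xy yx.
Qed.

Lemma prod_le_trans : transitive prod_le.
Proof.
move=> y x z /asboolP xy /asboolP yz.
by apply/asboolP => i; exact: le_trans (xy i) (yz i).
Qed.

HB.instance Definition _ := Order.Le_isPOrder.Build
  prod_lattice_display (prod_lattice L)
  prod_le_refl prod_le_anti prod_le_trans.

Definition prod_meet x y : prod_lattice L := fun i => Order.meet (x i) (y i).
Definition prod_join x y : prod_lattice L := fun i => Order.join (x i) (y i).

Lemma prod_meetP x y z : (x <= prod_meet y z) = (x <= y) && (x <= z).
Proof.
apply/asboolP/andP => [xyz|[/asboolP xy /asboolP xz] i].
- by split; apply/asboolP => i; have := xyz i; rewrite lexI => /andP[].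
- by rewrite lexI xy xz.
Qed.

Lemma prod_joinP x y z : (prod_join x y <= z) = (x <= z) && (y <= z).
Proof.
apply/asboolP/andP => [xyz|[/asboolP xz /asboolP yz] i].
- by split; apply/asboolP => i; have := xyz i; rewrite leUx => /andP[].
- by rewrite leUx xz yz.
Qed.

HB.instance Definition _ := Order.POrder_MeetJoin_isLattice.Build
  prod_lattice_display (prod_lattice L) prod_meetP prod_joinP.

End ProdLattice.

(* Closure under sublattices is expressed up to isomorphism. *)
Definition closed_sublattices (K : lattice_class) : Prop :=
  forall d (L : latticeType d) d' (M : latticeType d'),
    lattice_embeds L M -> K d' M -> K d L.

Definition closed_images (K : lattice_class) : Prop :=
  forall d (L : latticeType d) d' (M : latticeType d') (f : {lmorphism L -> M}),
    (forall y, exists x, f x = y) -> K d L -> K d' M.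

Definition closed_products (K : lattice_class) : Prop :=
  forall (I : Type) (d : I -> Order.disp_t) (L : forall i, latticeType (d i)),
    (forall i, K (d i) (L i)) -> K _ (prod_lattice L).

Definition is_variety (K : lattice_class) : Prop :=
  [/\ closed_images K, closed_sublattices K & closed_products K].

Definition subclass (K K' : lattice_class) : Prop :=
  forall d (L : latticeType d), K d L -> K' d L.

Definition proper_subvariety (K K' : lattice_class) : Prop :=
  [/\ is_variety K, is_variety K', subclass K K' & ~ subclass K' K].

(* Main.v *)
Require Import Defs.
From mathcomp Require Import all_boot all_order.
From HB Require Import structures.
From mathcomp Require Import finmap.
From mathcomp Require Import boolp classical_sets filter.

Set Implicit Arguments.
Unset Strict Implicit.
Unset Printing Implicit Defensive.

Import Order.TTheory.
Local Open Scope order_scope.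
Local Open Scope classical_set_scope.

(** A lattice lies in [SUB n] exactly when it can be represented by points: a
    type with a reflexive transitive relation that strictly increases a rank
    bounded by [n], and a map from the lattice to sets of points which turns
    meets into intersections, sends everything to convex sets, reflects the
    order, and places each point of [x \/ y] outside [x] and [y] between a
    point of [x] and a point of [y] ([SUB_rep], [rep_SUB]).  Closure under
    sublattices is composition, and a product is represented on the disjoint
    sum of the factors' points ([product_rep]).

    The substance is closure under a homomorphic image [f : L -> M].  The
    points of [M] are those ultrafilters [q] on the points of [L] for which
    membership of the set of [x] in [q] depends only on [f x]; such [q] are
    called saturated, and [m] holds at [q] when the set of some, equivalently
    every, [x] with [f x = m] belongs to [q]. Ultrafilters are compared by [p
    <= q] when the up-closure of every member of [p] is a member of [q]. In
    general this is only a preorder, but the finite rank survives: an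
    ultrafilter concentrates on one rank level, each level is an antichain,
    and hence the relation is antisymmetric and again of length at most [n]
    ([ultra_le_rank]).
    There are enough saturated ultrafilters because of filters of [M] that are
    maximal among those avoiding a down-set ([maximal_lfilter]).  If [m] is not
    below [c], a filter [X] that is maximal for containing [m] and not [c]
    is the trace of an ultrafilter, which separates [m] from [c]
    ([ultra_separation]).
    If [x \/ y] holds at [q] while [x] and [y] do not, take filters [X] above
    [x] and [Y] above [y], successively maximal subject to all [u \/ v] with
    [u] in [X] and [v] in [Y] holding at [q].  Compactness gives ultrafilters
    [a] and [b] containing the lifts of [X] and of [Y], with [q] between them;
    any further element holding at [a] would contradict the maximality of [X],
    so that [X] is the exact trace of [a], and [a] is saturated; likewise for
    [b] ([ultra_interpolation]).

    For chains, suppose that the convex sets of the [m]-element chain are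
    represented, and call a point proper at [k] if it belongs to [{k}] and not
    to the empty set.  A proper point at [k] lies between proper points at
    [k - 1] and [k + 1], in one of the two directions.  Once one step goes
    upwards, all later ones must, as otherwise a point of [{k}] would lie
    between two points of [{k - 1}].  Thus the rank takes [m] values, and
    [m <= n + 1].  Properness of the inclusion is the case [m = n + 2]. *)

(** * Posets of bounded length and rank functions *)

Lemma rank_length_at_most d (P : porderType d) n (r : P -> nat) :
  (forall x y, x < y -> (r x < r y)%N) -> (forall x, (r x <= n)%N) ->
  length_at_most P n.
Proof.
move=> r_lt r_le C chainC.
have r_inj : {in C &, injective r}.
  move=> x y Cx Cy rxy; apply: contrapT => /eqP xNy.
  by have [] := comparable_ltgtP (chainC x y Cx Cy) => [/r_lt|/r_lt|/eqP];
    rewrite ?rxy ?ltnn// (negbTE xNy).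
have rC_uniq : uniq (map r C) by rewrite map_inj_in_uniq ?fset_uniq.
have rC_sub : {subset map r C <= iota 0 n.+1}.
  by move=> _ /mapP[x _ ->]; rewrite mem_iota /= add0n ltnS.
have := uniq_leq_size rC_uniq rC_sub.
by rewrite size_map size_iota leq_subLR add1n.
Qed.

(** A point is ranked by the length of the longest chain of which it is the
    top: adding a larger point lengthens such a chain. *)
Lemma length_at_most_rank d (P : porderType d) n : length_at_most P n ->
  exists r : P -> nat,
    (forall x y, x < y -> (r x < r y)%N) /\ (forall x, (r x <= n)%N).
Proof.
move=> lenP.
pose Q x k := `[< exists C : {fset P},
  [/\ {in C &, forall y z : P, y >=< z}, x \in C,
      {in C, forall y, y <= x} & #|` C| = k.+1] >].
have exQ x : exists k, Q x k.
  exists 0; apply/asboolP; exists [fset x]%fset; split; rewrite ?cardfs1 ?inE//.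
  - by move=> y z; rewrite !inE => /eqP -> /eqP ->; exact: comparablexx.
  - by move=> y; rewrite !inE => /eqP ->.
have leQ x k : Q x k -> (k <= n)%N.
  by move=> /asboolP[C [chC _ _ cC]]; have := lenP C chC; rewrite cC subn1.
exists (fun x => ex_maxn (exQ x) (leQ x)); split; last first.
  by move=> x; case: ex_maxnP => k /leQ.
move=> x y xy; case: ex_maxnP => k /asboolP[C [chC Cx leC cC]] _.
case: ex_maxnP => l _; apply; apply/asboolP.
have Cy z : z \in C -> z < y by move=> /leC zx; exact: le_lt_trans xy.
exists (y |` C)%fset; split.
- move=> z t; rewrite !inE => /orP[/eqP ->|Cz] /orP[/eqP ->|Ct].
  + exact: comparablexx.
  + by rewrite comparable_sym lt_comparable// Cy.
  + by rewrite lt_comparable// Cy.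
  + exact: chC.
- by rewrite !inE eqxx.
- by move=> z; rewrite !inE => /orP[/eqP ->//|/Cy /ltW].
- rewrite cardfsU1 cC; case: (boolP (y \in C)) => // /Cy.
  by rewrite ltxx.
Qed.

(** * Point representations *)

(** An embedding into a lattice of convex sets, in elementary terms.  The rank
    condition [rep_rank] at once makes [R] antisymmetric and bounds the length
    of chains, so that constructions of points need no other control. *)
Record point_rep (n : nat) d (L : latticeType d) (T : Type)
    (R : T -> T -> Prop) (r : T -> nat) (phi : L -> set T) : Prop := PointRep {
  rep_refl : forall a, R a a;
  rep_trans : forall a b c, R a b -> R b c -> R a c;
  rep_rank : forall a b, R a b -> a = b \/ (r a < r b)%N;
  rep_bound : forall a, (r a <= n)%N;
  rep_convex : forall x a b q, phi x a -> phi x b -> R a q -> R q b -> phi x q;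
  rep_meet : forall x y, phi (Order.meet x y) = phi x `&` phi y;
  rep_join : forall x y q, phi (Order.join x y) q ->
    [\/ phi x q, phi y q | exists a b,
       [/\ phi x a, phi y b & (R a q /\ R q b) \/ (R b q /\ R q a)]];
  rep_sep : forall x y, phi x `<=` phi y -> x <= y }.

Lemma rep_le n d (L : latticeType d) T R r (phi : L -> set T) :
  point_rep n R r phi -> forall x y, x <= y -> phi x `<=` phi y.
Proof.
by move=> rep x y /meet_idPl <-; rewrite (rep_meet rep) => a [].
Qed.

Fact point_display : Order.disp_t. Proof. exact: Order.Disp tt tt. Qed.

Lemma Co_join_cases d (P : porderType d) (X Y : Co P) (q : P) :
  co_set (Order.join X Y) q ->
  [\/ co_set X q, co_set Y q | exists a b,
     [/\ co_set X a, co_set Y b & (a <= q /\ q <= b) \/ (b <= q /\ q <= a)]].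
Proof.
move=> [a [b [[Xa|Ya] [Xb|Yb] aq qb]]].
- by constructor 1; exact: (co_convex Xa Xb aq qb).
- by constructor 3; exists a, b; split=> //; left.
- by constructor 3; exists b, a; split=> //; right.
- by constructor 2; exact: (co_convex Ya Yb aq qb).
Qed.

(** Monotonicity, which the bundled morphisms ask for, follows from
    compatibility with meets. *)
Lemma lattice_embeds_fun d (L : latticeType d) d' (K : latticeType d')
  (f : L -> K) :
  {morph f : x y / Order.meet x y >-> Order.meet x y} ->
  {morph f : x y / Order.join x y >-> Order.join x y} ->
  injective f -> lattice_embeds L K.
Proof.
move=> fI fU f_inj.
have f_le : {homo f : x y / x <= y}.
  by move=> x y /meet_idPl xy; apply/meet_idPl; rewrite -fI xy.
pose g := HB.pack_for {omorphism L -> K} f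
  (Order.isOrderMorphism.Build _ _ _ _ f f_le).
pose h := HB.pack_for {lmorphism L -> K} (Order.OrderMorphism.sort g)
  (Order.isLatticeMorphism.Build _ _ _ _ (Order.OrderMorphism.sort g) fI fU).
by exists h.
Qed.

Lemma SUB_rep n d (L : latticeType d) : SUB n L ->
  exists T R r (phi : L -> set T), point_rep n R r phi.
Proof.
move=> [d' [P [/length_at_most_rank[r [r_lt r_le]] [f f_inj]]]].
exists P, (fun x y => x <= y), r, (fun x => co_set (f x)).
split=> //.
- by move=> a b c; exact: le_trans.
- by move=> a b; rewrite le_eqVlt => /orP[/eqP|/r_lt]; [left|right].
- by move=> x a b q Xa Xb; exact: (co_convex Xa Xb).
- by move=> x y; rewrite omorphI.
- by move=> x y q; rewrite omorphU; exact: Co_join_cases.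
- move=> x y /leCoP fxy; apply/meet_idPl/f_inj.
  by rewrite omorphI; apply/meet_idPl.
Qed.

Lemma rep_SUB n d (L : latticeType d) T R r (phi : L -> set T) :
  point_rep n R r phi -> SUB n L.
Proof.
move=> rep.
pose le (x y : T) : bool := `[< R x y >].
have R_refl : reflexive le by move=> x; apply/asboolP/(rep_refl rep).
have R_anti : antisymmetric le.
  move=> x y /andP[/asboolP /(rep_rank rep) [//|xy]].
  move=> /asboolP /(rep_rank rep) [//|] /(ltn_trans xy).
  by rewrite ltnn.
have R_trans : transitive le.
  move=> y x z /asboolP xy /asboolP yz.
  by apply/asboolP; exact: (rep_trans rep xy yz).
pose Tc := HB.pack_for choiceType T (gen_eqMixin T) (gen_choiceMixin T).
pose P := HB.pack_for (porderType point_display) (Choice.sort Tc)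
  (Order.Le_isPOrder.Build point_display Tc R_refl R_anti R_trans).
exists point_display, P; split.
  apply: (@rank_length_at_most _ P n r) (rep_bound rep) => x y xy.
  have /asboolP /(rep_rank rep)[exy|//] : le x y by exact: (@ltW _ P).
  by move: xy; rewrite exy ltxx.
have conv x : `[< @order_convex _ P (phi x) >].
  apply/asboolP => a b q xa xb /asboolP aq /asboolP qb.
  exact: (rep_convex rep xa xb aq qb).
pose f (x : L) : Co P := MkCo (conv x).
have fI : {morph f : x y / Order.meet x y >-> Order.meet x y}.
  by move=> x y; apply/val_inj; rewrite /= (rep_meet rep).
have f_le : {homo f : x y / x <= y}.
  by move=> x y xy; apply/leCoP; exact: (rep_le rep).
have fU : {morph f : x y / Order.join x y >-> Order.join x y}.
  move=> x y; apply/le_anti/andP; split; last first.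
    by rewrite leUx !f_le ?leUl ?leUr.
  apply/leCoP => q /(rep_join rep)[xq|yq|[a [b [xa yb H]]]].
  - by exists q, q; split; rewrite ?lexx//; left.
  - by exists q, q; split; rewrite ?lexx//; right.
  - case: H => -[/asboolP u /asboolP v].
    + by exists a, b; split=> //; [left|right].
    + by exists b, a; split=> //; [right|left].
apply: (lattice_embeds_fun fI fU) => x y /(congr1 (@co_set _ P)) /= exy.
by apply/le_anti; rewrite !(rep_sep rep) ?exy.
Qed.

(** * Sublattices and products *)

Lemma SUB_sublattices n : closed_sublattices (SUB n).
Proof.
move=> d L d' M [g g_inj] [e [P [lenP [f f_inj]]]].
exists e, P; split=> //; apply: (@lattice_embeds_fun _ _ _ _ (f \o g)).
- by move=> x y /=; rewrite !omorphI.
- by move=> x y /=; rewrite !omorphU.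
- by move=> x y /f_inj/g_inj.
Qed.

(** The indices are compared by an equality proof, since an arbitrary index
    type has no decidable equality. *)
Definition sum_rel (I : Type) (T : I -> Type) (R : forall i, T i -> T i -> Prop)
    (x y : {i & T i}) : Prop :=
  exists h : projT1 x = projT1 y,
    R _ (eq_rect _ T (projT2 x) _ h) (projT2 y).

Lemma sum_relE (I : Type) (T : I -> Type) (R : forall i, T i -> T i -> Prop)
    i (a b : T i) :
  sum_rel R (existT _ i a) (existT _ i b) <-> R i a b.
Proof.
split=> [[/= h]|ab]; last by exists erefl.
by rewrite (Prop_irrelevance h erefl).
Qed.

Lemma product_rep n (I : Type) (d : I -> Order.disp_t)
    (L : forall i, latticeType (d i)) (T : I -> Type)
    (R : forall i, T i -> T i -> Prop) (r : forall i, T i -> nat)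
    (phi : forall i, L i -> set (T i)) :
  (forall i, point_rep n (@R i) (@r i) (@phi i)) ->
  point_rep n (L := prod_lattice L) (sum_rel R) (fun p => @r _ (projT2 p))
    (fun (x : prod_lattice L) =>
       [set p | @phi (projT1 p) (x (projT1 p)) (projT2 p)]).
Proof.
move=> rep; split.
- by move=> [i a]; apply/sum_relE/(rep_refl (rep i)).
- move=> [i a] [j b] [k c] [/= ij ab] [/= jk bc]; subst j k.
  by apply/sum_relE; exact: (rep_trans (rep i) ab bc).
- move=> [i a] [j b] [/= ij ab]; subst j.
  by case: (rep_rank (rep i) ab) => /= [ab'|]; [left; rewrite ab'|right].
- by move=> [i a]; exact: (rep_bound (rep i)).
- move=> x [i a] [j b] [k q] /= xa xb [/= ik aq] [/= kj qb]; subst k j.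
  exact: (rep_convex (rep i) xa xb aq qb).
- move=> x y; apply/seteqP; split=> -[i a] /=.
  + by rewrite (rep_meet (rep i)).
  + by move=> ?; rewrite (rep_meet (rep i)).
- move=> x y [i q] /= /(rep_join (rep i))[xq|yq|[a [b [xa yb H]]]].
  + by constructor 1.
  + by constructor 2.
  + constructor 3; exists (existT _ i a), (existT _ i b); split=> //.
    by case: H => -[u v]; [left|right]; split; apply/sum_relE.
- move=> x y xy; apply/asboolP => i; apply: (rep_sep (rep i)) => a.
  exact: (xy (existT _ i a)).
Qed.

Lemma SUB_products n : closed_products (SUB n).
Proof.
move=> I d L SUBL.
have reps i : {T & {R : T -> T -> Prop & {r & {phi : L i -> set T |
    point_rep n R r phi}}}}.
  have /cid[T /cid[R /cid[r /cid[phi rep]]]] := SUB_rep (SUBL i).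
  by exists T, R, r, phi.
exact: rep_SUB (product_rep
  (fun i => svalP (projT2 (projT2 (projT2 (reps i)))))).
Qed.

(** * Homomorphic images *)

Definition image_rel T (R : T -> T -> Prop) (A : set T) : set T :=
  [set y | exists2 x, A x & R x y].

Lemma ultra_of_base T (G : set (set T)) : G !=set0 ->
  (forall A B, G A -> G B -> exists2 C, G C & C `<=` A `&` B) ->
  (forall A, G A -> A !=set0) ->
  exists2 q : set (set T), UltraFilter q & G `<=` q.
Proof.
move=> [A0 GA0] GI Gn0.
have /ultraFilterLemma[q [qU Gq]] : ProperFilter (filter_from G id).
  apply: filter_from_proper => //.
  by apply: filter_from_filter; [exists A0|].
by exists q => // A GA; apply: Gq; exists A.
Qed.

Lemma ultraC T (q : set (set T)) (A : set T) : UltraFilter q ->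
  q (~` A) <-> ~ q A.
Proof.
move=> qU; split=> [nA qA|nA].
  apply: (@filter_not_empty _ q).
  by rewrite -(setICr A); exact: filterI.
by have [] := in_ultra_setVsetC A qU.
Qed.

Lemma ultraU T (q : set (set T)) (A B : set T) : UltraFilter q ->
  q (A `|` B) -> q A \/ q B.
Proof.
move=> qU qAB; have [|/(ultraC _ qU) nA] := pselect (q A); first by left.
right; apply: filterS (filterI qAB nA).
by move=> x [[]].
Qed.

Lemma ultra_sub T (p q : set (set T)) : UltraFilter p -> UltraFilter q ->
  p `<=` q -> p = q.
Proof. by move=> pU qU pq; apply/esym/(@max_filter _ p pU q) => //. Qed.

(** The extension of a relation to ultrafilters can be tested from either
    side.  If the set of predecessors of [A] is not in [p], its complement is,
    so [q] contains the successors of points that have no successor in [A];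
    these lie outside [A], which therefore is not in [q]. *)
Lemma ultra_rel_sym T (R : T -> T -> Prop) (p q : set (set T)) :
  UltraFilter p -> UltraFilter q ->
  (forall A, p A -> q (image_rel R A)) ->
  forall A, q A -> p (image_rel (fun x y => R y x) A).
Proof.
move=> pU qU pq A qA; apply: contrapT => /(ultraC _ pU)/pq qB.
have [y [Ay [x nx xy]]] := filter_ex (filterI qA qB).
by apply: nx; exists y.
Qed.

(** Compactness: a directed family of sets, each of which separately has
    [q]-almost all points as successors, lies in one ultrafilter related to [q].
    It is generated by the family together with the predecessor sets of the
    members of [q]. *)
Lemma ultra_witness T (R : T -> T -> Prop) (q X : set (set T)) :
  UltraFilter q -> X !=set0 ->
  (forall A B, X A -> X B -> exists2 C, X C & C `<=` A `&` B) ->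
  (forall A, X A -> q (image_rel R A)) ->
  exists p : set (set T), [/\ UltraFilter p, X `<=` p &
    forall A, p A -> q (image_rel R A)].
Proof.
move=> qU [A0 XA0] XI Xq; pose R' x y := R y x.
pose G := [set C | exists A B, [/\ X A, q B & C = A `&` image_rel R' B]].
have [| | |p pU Gp] := @ultra_of_base _ G.
- by exists (A0 `&` image_rel R' setT), A0, setT; split=> //; exact: filterT.
- move=> _ _ [A1 [B1 [XA1 qB1 ->]]] [A2 [B2 [XA2 qB2 ->]]].
  have [C XC sC] := XI _ _ XA1 XA2.
  exists (C `&` image_rel R' (B1 `&` B2)).
    by exists C, (B1 `&` B2); split=> //; exact: filterI.
  by move=> x [/sC[Ax Bx] [y [B1y B2y] xy]]; split; split=> //; exists y.
- move=> _ [A [B [XA qB ->]]].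
  have [y [By [x Ax xy]]] := filter_ex (filterI qB (Xq _ XA)).
  by exists x; split=> //; exists y.
have pB B : q B -> p (image_rel R' B).
  move=> qB; apply: filterS (Gp _ _); last by exists A0, B; split.
  by move=> x [].
exists p; split=> //; last exact: (ultra_rel_sym (R := R')).
move=> A XA; apply: filterS (Gp (A `&` image_rel R' setT) _).
  by move=> x [].
by exists A, setT; split=> //; exact: filterT.
Qed.

Record lattice_filter d (M : latticeType d) (F : set M) : Prop :=
  LatticeFilter {
  lfilterI : forall x y, F x -> F y -> F (Order.meet x y);
  lfilterS : forall x y, F x -> x <= y -> F y }.

(** Zorn's lemma, applied to filters [F] whose elements stay out of [N] even
    after meeting them with [m]; the empty filter is allowed, so that empty
    chains cause no trouble, and maximality forces [m] into [F]. *)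
Lemma maximal_lfilter d (M : latticeType d) (N : set M) (m : M) :
  (forall x y, N y -> x <= y -> N x) -> ~ N m ->
  exists F, [/\ lattice_filter F, F m, (forall x, F x -> ~ N x) &
    forall x, ~ F x -> exists2 w, F w & N (Order.meet w x)].
Proof.
move=> Ndown Nm.
pose Q (F : set M) := lattice_filter F /\ forall x, F x -> ~ N (Order.meet m x).
have [|F [[Ff FN] Fmax]] := @Zorn_bigcup _ Q.
  move=> C CQ Ctot; split; last by move=> x [F /CQ[_ FN] /FN].
  split=> [x y [F CF Fx] [G CG Gy]|x y [F CF Fx] xy].
    have [FG|GF] := Ctot _ _ CF CG.
    - by exists G => //; apply: (lfilterI (CQ _ CG).1) => //; exact: FG.
    - by exists F => //; apply: (lfilterI (CQ _ CF).1) => //; exact: GF.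
  by exists F => //; exact: (lfilterS (CQ _ CF).1 Fx).
(* Otherwise the filter generated by [F] and [m /\ x] would be larger. *)
have Fadd x : ~ N (Order.meet m x) ->
    (forall w, F w -> ~ N (Order.meet w (Order.meet m x))) -> F x.
  move=> N1 N2; set u := Order.meet m x.
  pose B := [set z | u <= z \/ exists2 w, F w & Order.meet w u <= z].
  have FB : F `<=` B by move=> z Fz; right; exists z => //; exact: leIl.
  have QB : Q B.
    split; first split.
    - move=> y z [uy|[w Fw wy]] [uz|[v Fv vz]].
      + by left; rewrite lexI uy.
      + right; exists v => //; rewrite lexI vz andbT.
        exact: le_trans (leIr _ _) uy.
      + right; exists w => //; rewrite lexI wy /=.
        exact: le_trans (leIr _ _) uz.
      + right; exists (Order.meet w v); first exact: (lfilterI Ff).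
        rewrite lexI (le_trans _ wy) ?(le_trans _ vz)//.
        * by rewrite leI2// leIr.
        * by rewrite leI2// leIl.
    - by move=> y z [uy|[w Fw wy]] yz; [left|right; exists w => //];
        exact: le_trans yz.
    - move=> z [uz|[w Fw wz]] Nz.
      + by apply/N1/(Ndown _ _ Nz); rewrite lexI leIl.
      + apply/(N2 w Fw)/(Ndown _ _ Nz); rewrite lexI wz andbT.
        by rewrite (le_trans (leIr _ _))// leIl.
  apply: contrapT => nFx; apply: (Fmax B) QB; split=> // BF.
  by apply/nFx/BF; left; exact: leIr.
have Fm : F m.
  apply: Fadd; rewrite meetxx// => w Fw; rewrite meetC; exact: FN.
exists F; split=> //.
  by move=> x Fx Nx; apply: (FN x Fx); exact: Ndown Nx (leIr _ _).
move=> x nFx; apply: contrapT => nw; apply: nFx; apply: Fadd.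
  by move=> Nx; apply: nw; exists m.
move=> w Fw Nw; apply: nw; exists (Order.meet w m); first exact: (lfilterI Ff).
by rewrite -meetA.
Qed.

Section Image.
Context (n : nat) d (L : latticeType d) d' (M : latticeType d').
Context (f : {lmorphism L -> M}) (f_surj : forall y, exists x, f x = y).
Context (T : Type) (R : T -> T -> Prop) (r : T -> nat) (phi : L -> set T).
Hypothesis rep : point_rep n R r phi.

Let f_meet u v : f (Order.meet u v) = Order.meet (f u) (f v).
Proof. exact: omorphI. Qed.

Let f_join u v : f (Order.join u v) = Order.join (f u) (f v).
Proof. exact: omorphU. Qed.

Definition saturated (q : set (set T)) : Prop :=
  forall x y, f x = f y -> q (phi x) -> q (phi y).

Let up := image_rel R.
Let down := image_rel (fun x y => R y x).

Definition ultra_le (p q : set (set T)) : Prop := forall A, p A -> q (up A).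

Lemma ultra_le_down p q : UltraFilter p -> UltraFilter q ->
  ultra_le p q -> forall A, q A -> p (down A).
Proof. by move=> pU qU /(ultra_rel_sym pU qU). Qed.

Definition ultra_img (m : M) (q : set (set T)) : Prop :=
  exists2 x, f x = m & q (phi x).

Lemma ultra_imgE q x : saturated q -> ultra_img (f x) q <-> q (phi x).
Proof. by move=> qS; split=> [[y /qS]|]; [apply|exists x]. Qed.

(** The least [k] such that almost all points have rank at most [k]. *)
Lemma ultra_level (q : set (set T)) : UltraFilter q ->
  exists k, (k <= n)%N /\ q [set a | r a = k].
Proof.
move=> qU; have exk : exists k, `[< q [set a | (r a <= k)%N] >].
  exists n; apply/asboolP; apply: filterS filterT => a _.
  exact: (rep_bound rep).
case: (ex_minnP exk) => k /asboolP qk kmin.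
have kn : (k <= n)%N.
  apply: kmin; apply/asboolP; apply: filterS filterT => a _.
  exact: (rep_bound rep).
exists k; split=> //; case: k qk kmin {kn} => [|k] qk kmin.
  by apply: filterS qk => a /=; rewrite leqn0 => /eqP.
have /(ultraC _ qU) qk' : ~ q [set a | (r a <= k)%N].
  by move=> /asboolP/kmin; rewrite ltnn.
apply: filterS (filterI qk qk') => a /= [ak nak].
by apply/eqP; rewrite eqn_leq ak ltnNge; exact/negP.
Qed.

(** Within a rank level related points are equal, so for [p] and [q] on the
    same level every member of [p], cut down to that level, is its own
    up-closure there and hence belongs to [q]. *)
Lemma ultra_le_rank p q k l : UltraFilter p -> UltraFilter q ->
  p [set a | r a = k] -> q [set a | r a = l] -> ultra_le p q ->
  p = q \/ (k < l)%N.
Proof.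
move=> pU qU pk ql pq; case: (ltngtP k l) => [|lk|kl]; first by right.
  have [b [/= bl [a /= ak ab]]] := filter_ex (filterI ql (pq _ pk)).
  move: lk; rewrite -ak -bl.
  by case: (rep_rank rep ab) => [->|/ltnW]; rewrite ltnNge ?leqnn// => ->.
left; apply: ultra_sub => // A pA.
apply: filterS (filterI ql (pq _ (filterI pA pk))).
move=> b [/= bl [a [Aa /= ak] ab]].
by case: (rep_rank rep ab) => [<-//|]; rewrite ak bl kl ltnn.
Qed.

(** An ultrafilter chooses one of the four ways in which a point can lie in a
    join. *)
Lemma ultra_join q x y : UltraFilter q -> q (phi (Order.join x y)) ->
  [\/ q (phi x), q (phi y), q (up (phi x) `&` down (phi y)) |
      q (down (phi x) `&` up (phi y))].
Proof.
move=> qU qxy.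
have : q (phi x `|` (phi y `|` ((up (phi x) `&` down (phi y)) `|`
    (down (phi x) `&` up (phi y))))).
  apply: filterS qxy => c /(rep_join rep)[|?|[a [b [xa yb H]]]]; first by left.
    by right; left.
  by right; right; case: H => -[u v]; [left|right]; split;
    by [exists a|exists b].
move=> /(ultraU qU)[|/(ultraU qU)[|/(ultraU qU)[]]] ?;
  by [constructor 1|constructor 2|constructor 3|constructor 4].
Qed.

Lemma lfilter_trace q : UltraFilter q -> saturated q ->
  lattice_filter (ultra_img^~ q).
Proof.
move=> qU qS; split=> u v.
  move=> [x <- qx] [y <- qy]; rewrite -f_meet; apply/ultra_imgE => //.
  by rewrite (rep_meet rep); exact: filterI.
have [x <-] := f_surj u; have [y <-] := f_surj v.
move=> /(ultra_imgE _ qS) qx /meet_idPl; rewrite -f_meet => exy.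
apply/ultra_imgE => //; have /qS/(_ qx) := esym exy.
by apply: filterS; apply: rep_le rep _ _ _; exact: leIr.
Qed.

Lemma preim_directed (X : set M) m : lattice_filter X -> X m ->
  let G := [set phi u | u in [set u | X (f u)]] in
  G !=set0 /\ forall A B, G A -> G B -> exists2 C, G C & C `<=` A `&` B.
Proof.
move=> Xf Xm G; split.
  by have [u fu] := f_surj m; exists (phi u), u => //=; rewrite fu.
move=> _ _ [u Xu <-] [v Xv <-]; exists (phi (Order.meet u v)).
  by exists (Order.meet u v) => //=; rewrite f_meet; exact: (lfilterI Xf).
by rewrite (rep_meet rep).
Qed.

(** The sets [phi u] minus [phi v], for [f u] in a filter [X] maximal without
    [c] and [f v <= c], are nonempty and directed; the directedness in [v]
    comes from joins.  An ultrafilter containing them has trace exactly [X]: if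
    [phi u] is a member and [f u] is not in [X], maximality gives [w] in [X]
    with [w /\ f u <= c], an element which holds and must not hold. *)
Lemma ultra_separation (m c : M) : ~ m <= c ->
  exists q, [/\ UltraFilter q, saturated q, ultra_img m q & ~ ultra_img c q].
Proof.
move=> mc; have [|X [Xf Xm XN Xmax]] :=
    @maximal_lfilter _ M [set x | x <= c] m _ mc.
  by move=> x y yc xy; exact: le_trans yc.
pose G := [set A | exists u v, [/\ X (f u), f v <= c & A = phi u `&` ~` phi v]].
have [um fum] := f_surj m; have [uc fuc] := f_surj c.
have [| | |q qU Gq] := @ultra_of_base _ G.
- by exists (phi um `&` ~` phi uc), um, uc; rewrite fum fuc.
- move=> _ _ [u1 [v1 [Xu1 v1c ->]]] [u2 [v2 [Xu2 v2c ->]]].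
  exists (phi (Order.meet u1 u2) `&` ~` phi (Order.join v1 v2)).
    exists (Order.meet u1 u2), (Order.join v1 v2); split=> //.
      by rewrite f_meet; exact: (lfilterI Xf).
    by rewrite f_join leUx v1c.
  rewrite (rep_meet rep) => a [[a1 a2] na]; split; split=> //.
  + by move=> av; apply/na/(rep_le rep _ av)/leUl.
  + by move=> av; apply/na/(rep_le rep _ av)/leUr.
- move=> _ [u [v [Xu vc ->]]].
  apply: contrapT => /set0P/negP/negPn/eqP E.
  apply: (XN _ Xu) => /=; apply: le_trans vc; apply: omorph_le.
  apply: (rep_sep rep) => a ua; apply: contrapT => nva.
  by have : set0 a by rewrite -E.
have qX u : X (f u) -> q (phi u).
  by move=> Xu; apply: filterS (Gq (phi u `&` ~` phi uc) _);
    [move=> a []|exists u, uc; rewrite fuc].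
have qc v : f v <= c -> ~ q (phi v).
  move=> vc; apply/ultraC; apply: filterS (Gq (phi um `&` ~` phi v) _).
    by move=> a [].
  by exists um, v; rewrite fum.
have qXP u : q (phi u) -> X (f u).
  move=> qu; apply: contrapT => /Xmax[w Xw wuc].
  have [w' fw] := f_surj w; apply: (qc (Order.meet w' u)).
    by rewrite f_meet fw.
  by rewrite (rep_meet rep); apply: filterI => //; apply: qX; rewrite fw.
exists q; split=> //.
- by move=> x y fxy /qXP; rewrite fxy => /qX.
- by exists um => //; apply: qX; rewrite fum.
- by move=> [v fv]; apply: qc; rewrite fv.
Qed.

Definition ultra_between (a q b : set (set T)) : Prop :=
  (ultra_le a q /\ ultra_le q b) \/ (ultra_le b q /\ ultra_le q a).

Lemma ultra_between_join a q b u v :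
  UltraFilter a -> UltraFilter q -> UltraFilter b -> ultra_between a q b ->
  a (phi u) -> b (phi v) -> q (phi (Order.join u v)).
Proof.
move=> aU qU bU H au bv.
have lu := rep_le rep (leUl u v); have lv := rep_le rep (leUr v u).
case: H => -[H1 H2].
- apply: filterS (filterI (H1 _ au) (ultra_le_down qU bU H2 bv)).
  move=> c [[s us sc] [t vt ct]].
  exact: (rep_convex rep (lu _ us) (lv _ vt) sc ct).
- apply: filterS (filterI (H1 _ bv) (ultra_le_down qU aU H2 au)).
  move=> c [[s us sc] [t vt ct]].
  exact: (rep_convex rep (lv _ us) (lu _ vt) sc ct).
Qed.

(** The join condition for the image.  The down-set avoided by [X] is that of
    the [u] for which [u \/ y] fails at [q], and the one avoided by [Y] that of
    the [v] for which [u \/ v] fails at [q] for some [u] in [X]. *)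
Lemma ultra_interpolation (x y : M) q : UltraFilter q -> saturated q ->
  ultra_img (Order.join x y) q -> ~ ultra_img x q -> ~ ultra_img y q ->
  exists a b, [/\ UltraFilter a /\ saturated a, UltraFilter b /\ saturated b,
    ultra_img x a, ultra_img y b &
    (ultra_le a q /\ ultra_le q b) \/ (ultra_le b q /\ ultra_le q a)].
Proof.
move=> qU qS qxy nx ny; pose F := ultra_img^~ q.
have Ff : lattice_filter F by exact: lfilter_trace.
have [||X [Xf Xx XF Xmax]] :=
    @maximal_lfilter _ M [set u | ~ F (Order.join u y)] x.
- by move=> u v nv uv Fu; apply: nv; apply: (lfilterS Ff Fu); rewrite leU2.
- by apply; exact: qxy.
have [||Y [Yf Yy YF Ymax]] :=
    @maximal_lfilter _ M [set v | exists2 u, X u & ~ F (Order.join u v)] y.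
- move=> v w [u Xu nu] vw; exists u => // Fu; apply: nu.
  by apply: (lfilterS Ff Fu); rewrite leU2.
- by move=> [u /XF].
have XYF u v : X u -> Y v -> F (Order.join u v).
  move=> Xu Yv; apply: contrapT => nF; apply: (YF v Yv).
  by exists u.
have [x' fx] := f_surj x; have [y' fy] := f_surj y.
have nx' : ~ q (phi x') by rewrite -fx in nx => qx; apply: nx; exists x'.
have ny' : ~ q (phi y') by rewrite -fy in ny => qy; apply: ny; exists y'.
(* Shrinking to elements below [x'] and [y'] leaves only the two cases in
   which [q] lies between them. *)
have two u v : X (f u) -> Y (f v) ->
    q (up (phi u) `&` down (phi v)) \/ q (down (phi u) `&` up (phi v)).
  move=> Xu Yv.
  have : q (phi (Order.join (Order.meet u x') (Order.meet v y'))).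
    apply/ultra_imgE => //; rewrite f_join; apply: XYF; rewrite f_meet.
    - by apply: (lfilterI Xf) => //; rewrite fx.
    - by apply: (lfilterI Yf) => //; rewrite fy.
  have mono S (A B : set T) : A `<=` B -> image_rel S A `<=` image_rel S B.
    by move=> AB c [e /AB Be ec]; exists e.
  move=> /(ultra_join qU); rewrite !(rep_meet rep) => -[|||] H.
  - by case: nx'; apply: filterS H => ? [].
  - by case: ny'; apply: filterS H => ? [].
  - by left; apply: filterS H; apply: setISS; apply: mono => ? [].
  - by right; apply: filterS H; apply: setISS; apply: mono => ? [].
have Xx' : X (f x') by rewrite fx.
have Yy' : Y (f y') by rewrite fy.
(* One direction serves all pairs: if it fails for one pair, it fails for all
   smaller pairs, and any two pairs have a common smaller one. *)
have orient :
    ((forall u, X (f u) -> q (up (phi u))) /\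
     (forall v, Y (f v) -> q (down (phi v)))) \/
    ((forall u, X (f u) -> q (down (phi u))) /\
     (forall v, Y (f v) -> q (up (phi v)))).
  have [H|] := pselect (forall u v, X (f u) -> Y (f v) ->
      q (up (phi u) `&` down (phi v))).
    by left; split=> [u Xu|v Yv];
      [have := H u y' Xu Yy'|have := H x' v Xx' Yv]; apply: filterS => ? [].
  move=> /existsNP[u0 /existsNP[v0 /not_implyP[Xu0 /not_implyP[Yv0 nq]]]].
  have {}two u v : X (f u) -> Y (f v) -> q (down (phi u) `&` up (phi v)).
    move=> Xu Yv; have [| |H|] := two (Order.meet u u0) (Order.meet v v0).
    - by rewrite f_meet; exact: (lfilterI Xf).
    - by rewrite f_meet; exact: (lfilterI Yf).
    - case: nq; apply: filterS H; rewrite !(rep_meet rep).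
      by move=> c [[s [_ ? ?]] [t [_ ? ?]]]; split; [exists s|exists t].
    - apply: filterS; rewrite !(rep_meet rep).
      by move=> c [[s [? _ ?]] [t [? _ ?]]]; split; [exists s|exists t].
  by right; split=> [u Xu|v Yv];
    [have := two u y' Xu Yy'|have := two x' v Xx' Yv]; apply: filterS => ? [].
have [GX0 GXI] := preim_directed Xf Xx.
have [GY0 GYI] := preim_directed Yf Yy.
have {orient}[a [b [aU bU aX bY bet]]] : exists a b, [/\ UltraFilter a,
    UltraFilter b, forall u, X (f u) -> a (phi u),
    forall v, Y (f v) -> b (phi v) & ultra_between a q b].
  case: orient => -[HX HY].
  - have [|a [aU aX aq]] := ultra_witness (R := R) qU GX0 GXI.
      by move=> _ [u Xu <-]; exact: HX.
    have [|b [bU bY bq]] := ultra_witness (R := fun x y => R y x) qU GY0 GYI.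
      by move=> _ [v Yv <-]; exact: HY.
    exists a, b; split=> //.
    + by move=> u Xu; apply: aX; exists u.
    + by move=> v Yv; apply: bY; exists v.
    + by left; split=> //; exact: (ultra_rel_sym (R := fun x y => R y x)).
  - have [|a [aU aX aq]] := ultra_witness (R := fun x y => R y x) qU GX0 GXI.
      by move=> _ [u Xu <-]; exact: HX.
    have [|b [bU bY bq]] := ultra_witness (R := R) qU GY0 GYI.
      by move=> _ [v Yv <-]; exact: HY.
    exists a, b; split=> //.
    + by move=> u Xu; apply: aX; exists u.
    + by move=> v Yv; apply: bY; exists v.
    + by right; split=> //; exact: (ultra_rel_sym (R := fun x y => R y x)).
have joinF u v : a (phi u) -> b (phi v) -> F (Order.join (f u) (f v)).
  move=> au bv; rewrite -f_join; exists (Order.join u v) => //.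
  exact: (ultra_between_join aU qU bU bet).
(* The traces of [a] and [b] are exactly [X] and [Y], by maximality; this is
   what makes [a] and [b] saturated. *)
have Xa u : a (phi u) -> X (f u).
  move=> au; apply: contrapT => /Xmax[w Xw]; apply.
  have [w' fw] := f_surj w; rewrite -fw -f_meet -fy; apply: joinF; last first.
    exact: bY.
  by rewrite (rep_meet rep); apply: filterI => //; apply: aX; rewrite fw.
have Yb v : b (phi v) -> Y (f v).
  move=> bv; apply: contrapT => /Ymax[w Yw [u Xu]]; apply.
  have [w' fw] := f_surj w; have [u' fu] := f_surj u.
  rewrite -fw -f_meet -fu; apply: joinF; first by apply: aX; rewrite fu.
  by rewrite (rep_meet rep); apply: filterI => //; apply: bY; rewrite fw.
exists a, b; split=> //.
- by split=> // u v fuv /Xa; rewrite fuv => /aX.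
- by split=> // u v fuv /Yb; rewrite fuv => /bY.
- by exists x' => //; exact: aX.
- by exists y' => //; exact: bY.
Qed.

Lemma SUB_image : SUB n M.
Proof.
pose Q := {q : set (set T) | UltraFilter q /\ saturated q}.
have lev (q : Q) : exists k, (k <= n)%N /\ sval q [set a | r a = k].
  by apply: ultra_level; exact: (svalP q).1.
have {lev}[lev levP] := choice lev.
apply: (@rep_SUB n _ _ Q (fun p q => ultra_le (sval p) (sval q)) lev
  (fun m q => ultra_img m (sval q))).
split.
- move=> [q [qU qS]] A qA; apply: filterS qA => c Ac; exists c => //.
  exact: (rep_refl rep).
- move=> p [q [qU qS]] [s [sU sS]] pq qs A /pq/qs; apply: filterS.
  move=> c [b [a Aa ab] bc]; exists a => //; exact: (rep_trans rep ab bc).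
- move=> p q pq.
  have [epq|] := ultra_le_rank (svalP p).1 (svalP q).1 (levP p).2 (levP q).2 pq.
    by left; case: p q epq {pq} => [p pP] [q qP] /= epq; apply: eq_exist.
  by right.
- by move=> q; exact: (levP q).1.
- move=> m p q s; have [x <-] := f_surj m.
  move=> /(ultra_imgE _ (svalP p).2) px /(ultra_imgE _ (svalP q).2) qx ps sq.
  apply/ultra_imgE; first exact: (svalP s).2.
  rewrite -(joinxx x).
  apply: (ultra_between_join (svalP p).1 (svalP s).1 (svalP q).1) px qx.
  by left.
- move=> x y; apply/seteqP; split=> q /=;
    have [Fi Fs] := lfilter_trace (svalP q).1 (svalP q).2.
  + by move=> qxy; split; apply: Fs qxy _; [exact: leIl|exact: leIr].
  + by move=> [qx qy]; exact: Fi.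
- move=> x y [q [qU qS]] /= qxy.
  have [|nx] := pselect (ultra_img x q); first by constructor 1.
  have [|ny] := pselect (ultra_img y q); first by constructor 2.
  have [a [b [aQ bQ xa yb H]]] := ultra_interpolation qU qS qxy nx ny.
  by constructor 3; exists (exist _ a aQ), (exist _ b bQ).
- move=> m c mc; apply: contrapT => /ultra_separation[q [qU qS qm]]; apply.
  exact: (mc (exist _ q (conj qU qS))).
Qed.

End Image.

Lemma SUB_images n : closed_images (SUB n).
Proof.
move=> d L d' M f f_surj /SUB_rep[T [R [r [phi rep]]]].
exact: (SUB_image f_surj rep).
Qed.

Lemma SUB_variety n : is_variety (SUB n).
Proof.
by split; [exact: SUB_images|exact: SUB_sublattices|exact: SUB_products].
Qed.

(** * Convex subsets of finite chains *)

Lemma Co_chain_SUB m n : (m <= n + 1)%N -> SUB n (Co 'I_m).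
Proof.
move=> mn; exists _, 'I_m; split.
  apply: (@rank_length_at_most _ 'I_m n val) => // x.
  by rewrite -ltnS -(addn1 n); exact: leq_trans (ltn_ord x) mn.
exact: (@lattice_embeds_fun _ _ _ _ id).
Qed.

Lemma empty_convex d (P : porderType d) : `[< order_convex (set0 : set P) >].
Proof. by apply/asboolP => ?. Qed.

Definition Co_empty d (P : porderType d) : Co P := MkCo (@empty_convex _ P).

Lemma level_convex m k : `[< order_convex [set i : 'I_m | val i = k] >].
Proof.
apply/asboolP => x y z /= xk yk; rewrite !leEord xk yk => kz zk.
by apply/eqP; rewrite eqn_leq kz zk.
Qed.

(** The singleton [{k}]; indexing by natural numbers avoids bound proofs, and
    gives the empty set for [k >= m]. *)
Definition Co_point m k : Co 'I_m := MkCo (level_convex m k).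

(** Duality, used to orient the first step of the climb upwards. *)
Lemma rep_op n d (L : latticeType d) T R r (phi : L -> set T) :
  point_rep n R r phi ->
  point_rep n (fun a b => R b a) (fun a => n - r a)%N phi.
Proof.
move=> rep; split.
- exact: (rep_refl rep).
- by move=> a b c ba cb; exact: (rep_trans rep cb ba).
- move=> a b /(rep_rank rep)[|ba]; [by left|right].
  by rewrite ltn_sub2l// (leq_trans ba) ?(rep_bound rep).
- by move=> a; exact: leq_subr.
- by move=> x a b q xa xb qa bq; exact: (rep_convex rep xb xa bq qa).
- exact: (rep_meet rep).
- move=> x y q /(rep_join rep)[|?|[a [b [xa yb H]]]];
    [by constructor 1|by constructor 2|constructor 3].
  by exists a, b; split=> //; case: H => -[u v]; [right|left].
- exact: (rep_sep rep).
Qed.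

Section CoChain.
Context (n m : nat) (T : Type) (R : T -> T -> Prop) (r : T -> nat).
Context (phi : Co 'I_m -> set T).
Hypothesis rep : point_rep n R r phi.

Definition proper_point k : set T :=
  phi (Co_point m k) `\` phi (Co_empty 'I_m).

Lemma proper_point_ex k : (k < m)%N -> proper_point k !=set0.
Proof.
move=> km; apply: contrapT => /set0P/negP/negPn/eqP E.
have /leCoP/(_ (Ordinal km) erefl)// : Co_point m k <= Co_empty 'I_m.
apply: (rep_sep rep) => a ka; apply: contrapT => na.
by have : set0 a by rewrite -E.
Qed.

Lemma proper_point_disjoint i j a :
  proper_point i a -> phi (Co_point m j) a -> i = j.
Proof.
move=> [ia na] ja; apply: contrapT => ij; apply: na.
have : phi (Order.meet (Co_point m i) (Co_point m j)) a.
  by rewrite (rep_meet rep).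
by apply: (rep_le rep); apply/leCoP => x [/= -> ].
Qed.

(** As [{j}] is below the join of [{i}] and [{k}], [p] lies between some points
    of [{i}] and [{k}].  If one of these belonged to the empty set, both would
    belong to the same singleton, and by convexity so would [p]. *)
Lemma proper_point_between i j k p : (i < j < k)%N -> (k < m)%N ->
  proper_point j p -> exists a b, [/\ proper_point i a, proper_point k b &
    (R a p /\ R p b) \/ (R b p /\ R p a)].
Proof.
move=> /andP[ij jk] km pp.
have im : (i < m)%N by exact: ltn_trans (ltn_trans ij jk) km.
have emp l : phi (Co_empty 'I_m) `<=` phi (Co_point m l).
  by apply: (rep_le rep); apply/leCoP.
have [ni nk] : ~ phi (Co_point m i) p /\ ~ phi (Co_point m k) p.
  split=> /(proper_point_disjoint pp) E; first by rewrite E ltnn in ij.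
  by rewrite E ltnn in jk.
have : phi (Order.join (Co_point m i) (Co_point m k)) p.
  apply: (rep_le rep) (pp.1); apply/leCoP => x /= xj.
  exists (Ordinal im), (Ordinal km).
  by split; [left|right|rewrite leEord xj ltnW|rewrite leEord xj ltnW].
move=> /(rep_join rep)[//|//|[a [b [ia kb H]]]].
exists a, b; split=> //; split=> // e.
- apply: nk; have ka := emp k _ e.
  by case: H => -[];
    [exact: (rep_convex rep ka kb)|exact: (rep_convex rep kb ka)].
- apply: ni; have ib := emp i _ e.
  by case: H => -[];
    [exact: (rep_convex rep ia ib)|exact: (rep_convex rep ib ia)].
Qed.

Lemma proper_point_rank i j a b :
  proper_point i a -> proper_point j b -> i <> j -> R a b -> (r a < r b)%N.
Proof.
move=> ia jb ij /(rep_rank rep)[ab|//].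
by case: ij; apply: (proper_point_disjoint ia); rewrite ab; exact: jb.1.
Qed.

(** Given [p] below [q] at [k] and [k + 1], the point [q] lies between [c] at
    [k] and [e] at [k + 2].  If [q] were below [c], it would lie between the
    points [p] and [c] of [{k}]; so [q] is below [e], and the climb goes on. *)
Lemma Co_chain_climb a b : proper_point 0 a -> proper_point 1 b -> R a b ->
  forall k, (k.+1 < m)%N -> exists p q,
    [/\ proper_point k p, proper_point k.+1 q, R p q & (k < r q)%N].
Proof.
move=> a0 b1 ab; elim=> [|k IH] km.
  exists a, b; split=> //; exact: leq_ltn_trans (proper_point_rank a0 b1 _ ab).
have [p [q [kp kq pq rq]]] := IH (ltnW km).
have [|c [e [kc ke H]]] := @proper_point_between k k.+1 k.+2 q _ km kq.
  by rewrite !ltnSn.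
case: H => -[H1 H2].
- exists q, e; split=> //; apply: leq_ltn_trans rq _.
  by apply: (proper_point_rank kq ke) => // /eqP; rewrite ltn_eqF.
- have /(proper_point_disjoint kq)/eqP := rep_convex rep kp.1 kc.1 pq H2.
  by rewrite gtn_eqF.
Qed.

Lemma Co_chain_oriented a b :
  proper_point 0 a -> proper_point 1 b -> R a b -> (m <= n + 1)%N.
Proof.
move=> a0 b1 ab; have [|m2] := leqP m 1.
  by move/leq_trans; apply; rewrite addn1.
have [|p [q [_ _ _ rq]]] := Co_chain_climb a0 b1 ab (k := m.-2).
  by case: (m) m2 => [|[]].
have := leq_trans rq (rep_bound rep q).
by case: (m) m2 => [|[|m']] //= _; rewrite addn1 ltnS.
Qed.

End CoChain.

Lemma SUB_Co_chain m n : (0 < n)%N -> SUB n (Co 'I_m) -> (m <= n + 1)%N.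
Proof.
move=> n0 /SUB_rep[T [R [r [phi rep]]]].
have [m2|m2] := leqP m 2; first by rewrite (leq_trans m2)// addn1.
have [p p1] := proper_point_ex rep (ltnW m2).
have [a [c [a0 _ [[ap _]|[_ pa]]]]] :=
  proper_point_between rep (i := 0) (j := 1) (k := 2) isT m2 p1.
- exact: (Co_chain_oriented rep a0 p1 ap).
- exact: (Co_chain_oriented (rep_op rep) a0 p1 pa).
Qed.

Theorem corollary6p7 :
  (forall m n : nat, (0 < m)%N -> (0 < n)%N ->
     (SUB n (Co 'I_m) <-> (m <= n + 1)%N)) /\
  (forall n : nat, (0 < n)%N -> proper_subvariety (SUB n) (SUB (n + 1))).
Proof.
split=> [m n _ n0|n n0].
  by split; [exact: SUB_Co_chain|exact: Co_chain_SUB].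
split; [exact: SUB_variety|exact: SUB_variety| |].
- move=> d L [d' [P [lenP embP]]]; exists d', P; split=> // C /lenP lenC.
  by rewrite addn1 leqW.
- move=> /(_ _ _ (Co_chain_SUB (leqnn (n + 1 + 1)))) /(SUB_Co_chain n0).
  by rewrite addn1 ltnn.
Qed.
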